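(* Let $A_\Gamma$ be a large-type Artin group with $\Gamma$ connected. Suppose $f$ is an isometry of the Deligne complex $X_\Gamma$ which is $\psi$-equivariant for some $\psi\in\mathrm{Aut}(A_\Gamma)$, that is, $f(gx)=\psi(g)f(x)$ for all $g\in A_\Gamma$ and $x\in X_\Gamma$. Then $\psi\in\mathrm{Aut}_\Gamma(A_\Gamma)$.
   Context: Let $\Gamma$ be a finite simplicial graph with each edge $\{a,b\}$ labelled by an integer $m_{ab}\ge 2$; put $m_{ab}=\infty$ if $a\neq b$ are not adjacent. $A_\Gamma=\langle V(\Gamma)\mid \underbrace{aba\cdots}_{m_{ab}}=\underbrace{bab\cdots}_{m_{ab}}\ \text{for all edges }\{a,b\}\rangle$ is large-type if $m_{ab}\ge 3$ for all distinct $a,b$. $\mathrm{Aut}_\Gamma(A_\Gamma)\le\mathrm{Aut}(A_\Gamma)$ is the subgroup generated by all inner automorphisms $\varphi_g:h\mapsto ghg^{-1}$, all graph automorphisms (induced by label-preserving automorphisms of $\Gamma$), and the global inversion $\iota:a\mapsto a^{-1}$ for all $a\in V(\Gamma)$. Deligne complex (large-type case): for $S=\emptyset$, $S=\{s\}$ with $s\in V(\Gamma)$, or $S=\{s,t\}$ an edge of $\Gamma$, let $A_S=\langle S\rangle\le A_\Gamma$. The vertices of the simplicial complex $X_\Gamma$ are the left cosets $gA_S$ ($g\in A_\Gamma$), and chains of strict inclusions of such cosets span simplices. $A_\Gamma$ acts by left multiplication. $X_\Gamma$ carries the Moussong metric: the triangle on $gA_\emptyset,gA_{\{a\}},gA_{\{a,b\}}$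 is the Euclidean triangle with angle $\pi/(2m_{ab})$ at $gA_{\{a,b\}}$, angle $\pi/2$ at $gA_{\{a\}}$, and edge of length $1$ between $gA_\emptyset$ and $gA_{\{a\}}$ (each edge between $gA_\emptyset$ and $gA_{\{a\}}$ has length $1$); $X_\Gamma$ has the induced length metric. *)

(* Defs.v *)
From HB Require Import structures.
From mathcomp Require Import all_boot all_order all_algebra perm generic_quotient.
From mathcomp Require Import all_classical all_reals all_analysis.

Set Implicit Arguments.
Unset Strict Implicit.
Unset Printing Implicit Defensive.

Import Order.TTheory GRing.Theory Num.Theory.

Local Open Scope classical_set_scope.

Local Open Scope group_scope.

Section Groups.
Variable G : groupType.

Definition subgroup_closed (H : set G) : Prop :=
  [/\ H 1, forall x y, H x -> H y -> H (x * y) & forall x, H x -> H x^-1].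

Definition gen_subgroup (S : set G) : set G := smallest subgroup_closed S.

Definition lcoset_set (g : G) (B : set G) : set G := [set g * h | h in B].

Record aut := Aut {
  aut_fun :> G -> G;
  autM : {morph aut_fun : x y / x * y};
  aut_bij : bijective aut_fun }.

Lemma autP (p q : aut) : p =1 q -> p = q.
Proof.
case: p q => [p pM pB] [q qM qB] /= /funext pq; case: _ / pq in qM qB *.
by congr Aut; exact: Prop_irrelevance.
Qed.

HB.instance Definition _ := gen_eqMixin aut.
HB.instance Definition _ := gen_choiceMixin aut.

Definition aut_id : aut := @Aut id (fun _ _ => erefl) (Bijective (fun _ => erefl) (fun _ => erefl)).

Lemma aut_compM (p q : aut) : {morph p \o q : x y / x * y}.
Proof. by move=> x y /=; rewrite !autM. Qed.

Definition aut_comp (p q : aut) : aut :=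
  Aut (@aut_compM p q) (bij_comp (aut_bij p) (aut_bij q)).

Lemma aut_inv_ex (p : aut) : exists q : aut, cancel p q /\ cancel q p.
Proof.
have [q pK qK] := aut_bij p.
have qM : {morph q : x y / x * y}.
  by move=> x y; apply: (can_inj pK); rewrite autM !qK.
by exists (Aut qM (Bijective qK pK)).
Qed.

Definition aut_inv (p : aut) : aut := projT1 (cid (aut_inv_ex p)).

Lemma aut_compA : associative aut_comp.
Proof. by move=> p q r; apply: autP. Qed.
Lemma aut_comp1 : left_id aut_id aut_comp.
Proof. by move=> p; apply: autP. Qed.
Lemma aut_comp_1 : right_id aut_id aut_comp.
Proof. by move=> p; apply: autP. Qed.
Lemma aut_compV : left_inverse aut_id aut_inv aut_comp.
Proof.
by move=> p; apply: autP => x; rewrite /= /aut_inv; case: cid => q [] /=.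
Qed.
Lemma aut_comp_V : right_inverse aut_id aut_inv aut_comp.
Proof.
by move=> p; apply: autP => x; rewrite /= /aut_inv; case: cid => q [] /=.
Qed.

HB.instance Definition _ := isGroup.Build aut
  aut_compA aut_comp1 aut_comp_1 aut_compV aut_comp_V.

End Groups.

(* [lab a b] is meaningful only when [adj a b]; for distinct non-adjacent
   vertices the label is infinite and imposes no condition. *)
Record lgraph := LGraph {
  vert :> finType;
  adj : rel vert;
  lab : vert -> vert -> nat;
  adj_irr : irreflexive adj;
  adj_sym : symmetric adj;
  lab_sym : forall a b, lab a b = lab b a;
  lab_ge2 : forall a b, adj a b -> (2 <= lab a b)%N }.

Definition large_type (Γ : lgraph) : Prop :=
  forall a b : Γ, adj a b -> (3 <= lab a b)%N.

Definition connected_graph (Γ : lgraph) : Prop :=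
  forall a b : Γ, connect (@adj Γ) a b.

Definition label_preserving (Γ : lgraph) (s : {perm Γ}) : Prop :=
  (forall a b, adj (s a) (s b) = adj a b) /\
  (forall a b, adj a b -> lab (s a) (s b) = lab a b).

Section ArtinGroup.
Variable Γ : lgraph.

(* [(a, true)] stands for the letter a and [(a, false)] for its inverse. *)
Definition word := seq (Γ * bool).

Fixpoint alt_word (a b : Γ) (n : nat) : word :=
  if n is k.+1 then (a, true) :: alt_word b a k else [::].

Inductive artin_eqv : word -> word -> Prop :=
| artin_refl u : artin_eqv u u
| artin_sym u v : artin_eqv u v -> artin_eqv v u
| artin_trans u v w : artin_eqv u v -> artin_eqv v w -> artin_eqv u w
| artin_cat u u' v v' :
    artin_eqv u u' -> artin_eqv v v' -> artin_eqv (u ++ v) (u' ++ v')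
| artin_cancel a e : artin_eqv [:: (a, e); (a, ~~ e)] [::]
| artin_braid a b : adj a b ->
    artin_eqv (alt_word a b (lab a b)) (alt_word b a (lab a b)).

Definition artin_rel : rel word := fun u v => `[< artin_eqv u v >].

Lemma artin_rel_refl : reflexive artin_rel.
Proof. by move=> u; apply/asboolP; exact: artin_refl. Qed.
Lemma artin_rel_sym : symmetric artin_rel.
Proof. by move=> u v; apply/asboolP/asboolP; exact: artin_sym. Qed.
Lemma artin_rel_trans : transitive artin_rel.
Proof.
by move=> v u w /asboolP uv /asboolP vw; apply/asboolP; exact: artin_trans vw.
Qed.

Canonical artin_equiv :=
  EquivRel artin_rel artin_rel_refl artin_rel_sym artin_rel_trans.

Definition artin := {eq_quot artin_equiv}%qT.

HB.instance Definition _ := Choice.on artin.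

Definition artin_class (u : word) : artin := (\pi_{eq_quot artin_equiv} u)%qT.

Definition inv_word (u : word) : word := rev [seq (x.1, ~~ x.2) | x <- u].

Definition artin_one : artin := artin_class [::].
Definition artin_mul (x y : artin) : artin := artin_class (repr x ++ repr y).
Definition artin_inv (x : artin) : artin := artin_class (inv_word (repr x)).

Lemma artin_classP u v : artin_eqv u v <-> artin_class u = artin_class v.
Proof.
split=> [uv|/eqmodP /asboolP //]; first by apply/eqmodP/asboolP.
Qed.

Lemma artin_reprK x : artin_class (repr x) = x.
Proof. exact: reprK. Qed.

Lemma artin_repr u : artin_eqv (repr (artin_class u)) u.
Proof. by apply/artin_classP; rewrite artin_reprK. Qed.

Lemma artin_class_cat u v :
  artin_mul (artin_class u) (artin_class v) = artin_class (u ++ v).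
Proof. by apply/artin_classP; apply: artin_cat; exact: artin_repr. Qed.

Lemma inv_word_cons x u : inv_word (x :: u) = inv_word u ++ [:: (x.1, ~~ x.2)].
Proof. by rewrite /inv_word /= rev_cons cats1. Qed.

Lemma inv_wordK : involutive inv_word.
Proof.
move=> u; rewrite /inv_word map_rev revK -map_comp -[RHS]map_id.
by apply: eq_map => -[a e] /=; rewrite negbK.
Qed.

Lemma artin_invr_word u : artin_eqv (u ++ inv_word u) [::].
Proof.
elim: u => [|[a e] u IHu]; first exact: artin_refl.
rewrite inv_word_cons /= catA -cat1s.
apply: artin_trans (artin_cancel a e); rewrite -[[:: _; _]]cat1s.
apply: artin_cat; first exact: artin_refl.
by rewrite -[X in artin_eqv _ X]cat0s; apply: artin_cat => //; exact: artin_refl.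
Qed.

Lemma artin_mulA : associative artin_mul.
Proof.
move=> x y z; rewrite -(artin_reprK x) -(artin_reprK y) -(artin_reprK z).
by rewrite !artin_class_cat catA.
Qed.
Lemma artin_mul1 : left_id artin_one artin_mul.
Proof. by move=> x; rewrite -(artin_reprK x) artin_class_cat. Qed.
Lemma artin_mul_1 : right_id artin_one artin_mul.
Proof. by move=> x; rewrite -(artin_reprK x) artin_class_cat cats0. Qed.
Lemma artin_mulV : left_inverse artin_one artin_inv artin_mul.
Proof.
move=> x; rewrite -{2}(artin_reprK x) artin_class_cat; apply/artin_classP.
by rewrite -{2}[repr x]inv_wordK; exact: artin_invr_word.
Qed.
Lemma artin_mul_V : right_inverse artin_one artin_inv artin_mul.
Proof.
move=> x; rewrite -{1}(artin_reprK x) artin_class_cat; apply/artin_classP.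
exact: artin_invr_word.
Qed.

HB.instance Definition _ := isGroup.Build artin
  artin_mulA artin_mul1 artin_mul_1 artin_mulV artin_mul_V.

Definition gen (a : Γ) : artin := artin_class [:: (a, true)].

Definition inner_auts : set (aut artin) :=
  [set p | exists g : artin, forall h, p h = g * h * g^-1].

(* An automorphism is determined by its values on the generators; the set
   below thus has one element for each label-preserving s, and
   [global_inversions] has exactly one element. *)
Definition graph_auts : set (aut artin) :=
  [set p | exists s : {perm Γ},
     label_preserving s /\ forall a, p (gen a) = gen (s a)].

Definition global_inversions : set (aut artin) :=
  [set p | forall a, p (gen a) = (gen a)^-1].

Definition Aut_graph : set (aut artin) :=
  gen_subgroup (inner_auts `|` graph_auts `|` global_inversions).

Definition deligne_type (S : set Γ) : Prop :=
  [\/ S = set0, exists s, S = [set s]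
    | exists s t, adj s t /\ S = [set s; t]].

Definition parabolic (S : set Γ) : set artin := gen_subgroup (gen @` S).

Definition dcoset (g : artin) (S : set Γ) : set artin :=
  lcoset_set g (parabolic S).

Definition deligne_vertex (B : set artin) : Prop :=
  exists g S, deligne_type S /\ B = dcoset g S.

Local Open Scope ring_scope.
Variable R : realType.

(* A point of the geometric realization is given by its barycentric
   coordinates.  The sum is a finitely supported one (and 0 otherwise), so
   the last condition forces the support to be finite. *)
Record deligne := Deligne {
  bary :> set artin -> R;
  bary_vertex : forall B, bary B != 0 -> deligne_vertex B;
  bary_chain : forall B C, bary B != 0 -> bary C != 0 -> B `<=` C \/ C `<=` B;
  bary_ge0 : forall B, 0 <= bary B;
  bary_sum : \sum_(B \in [set: set artin]) bary B = 1 }.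

Lemma deligneP (x y : deligne) : bary x =1 bary y -> x = y.
Proof.
case: x y => [x x1 x2 x3 x4] [y y1 y2 y3 y4] /= /funext xy.
by case: _ / xy in y1 y2 y3 y4 *; congr Deligne; exact: Prop_irrelevance.
Qed.

Lemma lcoset1 (B : set artin) : lcoset_set 1%g B = B.
Proof.
rewrite /lcoset_set -[RHS]image_id; congr (_ @` _).
by apply/funext => h; rewrite mul1g.
Qed.

Lemma lcosetM (g h : artin) (B : set artin) :
  lcoset_set (g * h)%g B = lcoset_set g (lcoset_set h B).
Proof.
rewrite /lcoset_set image_comp; congr (_ @` _).
by apply/funext => k /=; rewrite mulgA.
Qed.

Lemma lcosetK (g : artin) : cancel (lcoset_set g) (lcoset_set g^-1%g).
Proof. by move=> B; rewrite -lcosetM mulVg lcoset1. Qed.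

Lemma lcosetVK (g : artin) : cancel (lcoset_set g^-1%g) (lcoset_set g).
Proof. by move=> B; rewrite -lcosetM mulgV lcoset1. Qed.

Section Action.
Variables (g : artin) (x : deligne).

(* (g . x) has at the vertex gB the coordinate of x at B. *)
Definition act_bary (B : set artin) : R := x (lcoset_set g^-1%g B).

Lemma act_vertex B : act_bary B != 0 -> deligne_vertex B.
Proof.
move=> /bary_vertex [h [S [S_type eqB]]]; exists (g * h)%g, S; split=> //.
by rewrite -[B](lcosetVK g) eqB /dcoset lcosetM.
Qed.

Lemma act_chain B C :
  act_bary B != 0 -> act_bary C != 0 -> B `<=` C \/ C `<=` B.
Proof.
move=> B0 C0; rewrite -[B](lcosetVK g) -[C](lcosetVK g).
by have [?|?] := bary_chain B0 C0; [left | right]; apply: image_subset.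
Qed.

Lemma act_ge0 B : 0 <= act_bary B.
Proof. exact: bary_ge0. Qed.

Lemma act_sum : \sum_(B \in [set: set artin]) act_bary B = 1.
Proof.
rewrite -(bary_sum x) /act_bary [RHS](reindex_fsbigT (lcoset_set g^-1%g)) //.
exact: Bijective (lcosetVK g) (lcosetK g).
Qed.

Definition deligne_act : deligne :=
  Deligne act_vertex act_chain act_ge0 act_sum.

End Action.

Definition supported (x : deligne) (s : set (set artin)) : Prop :=
  forall B, x B != 0 -> s B.

Definition cotan (t : R) : R := cos t / sin t.

(* Distance between points of the triangle gA_{}, gA_{a}, gA_{a,b}, which is
   placed in the plane with gA_{} at (1, 0), gA_{a} at (0, 0) and gA_{a,b} at
   (0, cot (pi / 2m)), m = m_ab: it then has a right angle at gA_{a}, angle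
   pi / 2m at gA_{a,b}, and an edge of length 1 from gA_{} to gA_{a}.  The
   point x lies at (x(gA_{}), x(gA_{a,b}) cot (pi / 2m)). *)
Definition triangle_dist (g : artin) (a b : Γ) (x y : deligne) : R :=
  Num.sqrt ((x (dcoset g set0) - y (dcoset g set0)) ^+ 2 +
    (cotan (pi / (2 * (lab a b)%:R)) *
       (x (dcoset g [set a; b]) - y (dcoset g [set a; b]))) ^+ 2).

(* [simplex_dist x y l]: x and y lie in a common closed simplex, in which
   their distance is l.  The second case is only needed for isolated vertices
   a of the graph; otherwise the edge lies in some triangle, and the two
   formulas agree. *)
Variant simplex_dist (x y : deligne) : R -> Prop :=
| InTriangle g a b of adj a b
    & supported x [set dcoset g set0; dcoset g [set a]; dcoset g [set a; b]]
    & supported y [set dcoset g set0; dcoset g [set a]; dcoset g [set a; b]] :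
    simplex_dist x y (triangle_dist g a b x y)
| InEdge g a of supported x [set dcoset g set0; dcoset g [set a]]
    & supported y [set dcoset g set0; dcoset g [set a]] :
    simplex_dist x y `|x (dcoset g set0) - y (dcoset g set0)|.

(* [string_length x y l]: there is a piecewise straight path from x to y of
   length l, each piece of which lies in one simplex. *)
Inductive string_length : deligne -> deligne -> R -> Prop :=
| StringNil x : string_length x x 0
| StringCons x y z l l' of simplex_dist x y l & string_length y z l' :
    string_length x z (l + l').

Definition deligne_dist (x y : deligne) : \bar R :=
  ereal_inf [set l%:E | l in string_length x y].

Definition deligne_isometry (f : deligne -> deligne) : Prop :=
  bijective f /\
  forall x y, deligne_dist (f x) (f y) = deligne_dist x y.

Definition equivariant (psi : aut artin) (f : deligne -> deligne) : Prop :=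
  forall g x, f (deligne_act g x) = deligne_act (psi g) (f x).

End ArtinGroup.

Arguments Aut_graph : clear implicits.

(* Main.v *)
Require Import Defs.
From mathcomp Require Import all_boot all_algebra all_classical all_reals.
From mathcomp Require Import all_order perm ereal trigo topology normedtype ring lra.

(* The points of the Deligne complex with trivial stabilizer are those of the
   open stars of the vertices {g}.  These stars are pairwise disjoint and open,
   since barycentric coordinates are Lipschitz for the length metric, so f maps
   the half-open segments from {1} towards the vertices <a> into one open star,
   that of {g} say.  In the limit f sends the vertex <a> to a point of the
   closed star of {g}; comparing stabilizers, psi <a> = g <c> g^-1 for some c,
   the case of a dihedral stabilizer being excluded as it is not abelian.
   Hence, up to conjugation by g, psi maps every generator a to s(a) or to its
   inverse, for a permutation s of the vertices.

   That s preserves edges and labels, and that the sign is the same at both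
   ends of an edge, is read off the reflection representation of the Hecke
   algebra with q = r^2.  At r = 1 (the Coxeter group) the braid relation of
   length m for s, t forces sin (m pi / m_st) = 0; at r = 3 it excludes a
   relation between s and t^-1. *)

Set Implicit Arguments.
Unset Strict Implicit.
Unset Printing Implicit Defensive.

Import Order.TTheory GRing.Theory Num.Theory.
Import numFieldNormedType.Exports.

Local Open Scope classical_set_scope.
Local Open Scope group_scope.

(** * Words and right actions of the Artin group *)

Fixpoint alternate (T : Type) (x y : T) (n : nat) : seq T :=
  if n is k.+1 then x :: alternate y x k else [::].

Section Words.
Variable Γ : lgraph.
Implicit Types (a b : Γ) (u v w : word Γ) (g h : artin Γ).

Lemma alt_wordE a b n : alt_word a b n = alternate (a, true) (b, true) n.
Proof. by elim: n a b => //= n IHn a b; rewrite IHn. Qed.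

Definition letter (l : Γ * bool) : artin Γ := artin_class [:: l].

Lemma artin_classM u v : artin_class (u ++ v) = artin_class u * artin_class v.
Proof. exact/esym/artin_class_cat. Qed.

Lemma artin_class_cons l w : artin_class (l :: w) = letter l * artin_class w.
Proof. exact: (artin_classM [:: l]). Qed.

Lemma letterE l : letter l = if l.2 then gen l.1 else (gen l.1)^-1.
Proof.
case: l => a [] //=; apply: (mulgI (gen a)); rewrite mulgV.
by rewrite -artin_class_cons; apply/artin_classP; exact: artin_cancel.
Qed.

Lemma artin_ind (P : artin Γ -> Prop) :
  P 1 -> (forall a g, P g -> P (gen a * g)) ->
  (forall a g, P g -> P ((gen a)^-1 * g)) -> forall g, P g.
Proof.
move=> P1 Pg PV g; rewrite -(artin_reprK g).
elim: (repr g) => [//|[a e] w IHw]; rewrite artin_class_cons letterE /=.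
by case: e; [apply: Pg | apply: PV].
Qed.

Section Run.
Variables (T : Type) (step : Γ * bool -> T -> T).

(** Letters are applied from the left end of the word on, so [ract] is a right action. The two
    hypotheses below are the defining relations, to be checked for each choice of [step]. *)
Definition run (w : word Γ) (x : T) : T := foldl (fun y l => step l y) x w.

Lemma run_cat u v x : run (u ++ v) x = run v (run u x).
Proof. exact: foldl_cat. Qed.

Hypothesis step_cancel : forall a e x, step (a, ~~ e) (step (a, e) x) = x.
Hypothesis step_braid : forall a b x, adj a b ->
  run (alt_word a b (lab a b)) x = run (alt_word b a (lab a b)) x.

Lemma run_eqv u v x : artin_eqv u v -> run u x = run v x.
Proof.
move=> uv; elim: uv x => {u v} //=.
- by move=> u v w _ uv _ vw x; rewrite uv.
- by move=> u u' v v' _ uu _ vv x; rewrite !run_cat uu vv.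
- by move=> a b ab x; exact: step_braid.
Qed.

Definition ract (g : artin Γ) (x : T) : T := run (repr g) x.

Lemma ract_class w x : ract (artin_class w) x = run w x.
Proof. exact/run_eqv/artin_repr. Qed.

Lemma ract1 x : ract 1 x = x.
Proof. exact: (ract_class [::]). Qed.

Lemma ractM g h x : ract (g * h) x = ract h (ract g x).
Proof.
by rewrite -{1}(artin_reprK g) -{1}(artin_reprK h) -artin_classM ract_class run_cat.
Qed.

Lemma ract_gen a x : ract (gen a) x = step (a, true) x.
Proof. exact: ract_class. Qed.

Lemma ractVK g x : ract g^-1 (ract g x) = x.
Proof. by rewrite -ractM mulgV ract1. Qed.

Lemma fixator_subgroup x : subgroup_closed [set g | ract g x = x].
Proof.
split=> [|g h /= gx hx|g /= gx]; first exact: ract1.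
  by rewrite ractM gx.
by rewrite -{1}gx ractVK.
Qed.

End Run.
End Words.

(** * The reflection representation of the Hecke algebra *)

Section Representation.
Variables (R : realType) (Γ : lgraph) (r : R).
Hypothesis r_gt0 : (0 < r)%R.
Local Open Scope ring_scope.
Implicit Types (a b : Γ) (phi : Γ -> R).

(** Off the diagonal this is -2r times the Tits form, with cos (pi / m) read as 1 for an infinite
    label; the diagonal entry gives each generator the eigenvalue -q. A function [phi] lists the
    values of a linear form on the simple roots. *)
Definition coupling a b : R :=
  if a == b then - (1 + r ^+ 2)
  else if adj a b then 2 * r * cos (pi / (lab a b)%:R) else 2 * r.

Definition rstep (l : Γ * bool) phi : Γ -> R :=
  fun b => phi b + coupling l.1 b * phi l.1 * (if l.2 then 1 else (r ^+ 2)^-1).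

(** For n > 0, [cheb c n] is r^(n-1) U_(n-1)(c / 2r), with U the Chebyshev polynomials of the second
    kind. *)
Fixpoint cheb (c : R) (n : nat) : R :=
  match n with
  | 0 => 0
  | 1 => 1
  | (k.+1 as m).+1 => c * cheb c m - r ^+ 2 * cheb c k
  end.

Lemma chebSS c n : cheb c n.+2 = c * cheb c n.+1 - r ^+ 2 * cheb c n.
Proof. by []. Qed.

Lemma couplingC a b : coupling a b = coupling b a.
Proof. by rewrite /coupling eq_sym adj_sym lab_sym; case: eqP => // ->. Qed.

Lemma rstep_self a phi : rstep (a, true) phi a = - r ^+ 2 * phi a.
Proof. by rewrite /rstep /coupling eqxx /=; ring. Qed.

Lemma rstep_other a b phi :
  rstep (a, true) phi b = phi b + coupling a b * phi a.
Proof. by rewrite /rstep mulr1. Qed.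

Lemma rstep_cancel a e phi : rstep (a, ~~ e) (rstep (a, e) phi) = phi.
Proof.
have r0 : r != 0 by rewrite gt_eqF.
apply/funext => b; rewrite /rstep /= /coupling eqxx.
by case: e; case: (a == b); case: (adj a b) => /=; field.
Qed.

(* The values z_k about to be used along an alternating word satisfy
   z_{k+1} = c z_k - r^2 z_{k-1}.  Comparing with [run_alt_last] for the word
   starting with b, the braid relation of length m amounts to [cheb c m = 0]. *)
Lemma run_alt_next a b phi n : a != b ->
  run rstep (alt_word a b n) phi (if odd n then b else a) =
  cheb (coupling a b) n.+1 * phi a + cheb (coupling a b) n * phi b.
Proof.
elim: n a b phi => [|n IHn] a b phi ab; first by rewrite /=; ring.
have -> : (if odd n.+1 then b else a) = (if odd n then a else b).
  by rewrite /=; case: odd.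
rewrite [LHS](IHn b a) 1?eq_sym // [coupling b a]couplingC.
rewrite rstep_self rstep_other chebSS; ring.
Qed.

Lemma run_alt_last a b phi n : a != b ->
  run rstep (alt_word a b n.+1) phi (if odd n then b else a) =
  - r ^+ 2 * (cheb (coupling a b) n.+1 * phi a + cheb (coupling a b) n * phi b).
Proof.
elim: n a b phi => [|n IHn] a b phi ab; first by rewrite [LHS]rstep_self /=; ring.
have -> : (if odd n.+1 then b else a) = (if odd n then a else b).
  by rewrite /=; case: odd.
rewrite [LHS](IHn b a) 1?eq_sym // [coupling b a]couplingC.
rewrite rstep_self rstep_other chebSS; ring.
Qed.

(** A step at a letter adds a multiple of the row of couplings of that letter. Two such words thus
    agree everywhere once they agree at a and b, provided the block of couplings of a and b is
    invertible. *)
Lemma run_alt_span a b n phi : exists P Q : R, forall d,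
  run rstep (alt_word a b n) phi d = phi d + coupling a d * P + coupling b d * Q.
Proof.
elim: n a b phi => [|n IHn] a b phi; first by exists 0, 0 => d /=; ring.
have [P [Q PQ]] := IHn b a (rstep (a, true) phi).
by exists (phi a + Q), P => d; rewrite [LHS]PQ rstep_other; ring.
Qed.

Lemma cheb_sin (t : R) n :
  r * sin t * cheb (2 * r * cos t) n = r ^+ n * sin (n%:R * t).
Proof.
suff: r * sin t * cheb (2 * r * cos t) n = r ^+ n * sin (n%:R * t) /\
      r * sin t * cheb (2 * r * cos t) n.+1 = r ^+ n.+1 * sin (n.+1%:R * t).
  by case.
elim: n => [|n [IH1 IH2]]; first by split; rewrite /= ?mul0r ?sin0 ?mul1r ?expr1; ring.
split=> //; transitivity (2 * r * cos t * (r * sin t * cheb (2 * r * cos t) n.+1)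
  - r ^+ 2 * (r * sin t * cheb (2 * r * cos t) n)); first by rewrite chebSS; ring.
rewrite IH1 IH2.
have -> : n.+2%:R * t = n.+1%:R * t + t by rewrite -[n.+2]addn1 natrD; ring.
have -> : n%:R * t = n.+1%:R * t - t by rewrite -[n.+1]addn1 natrD; ring.
rewrite sinB sinD !exprS; ring.
Qed.

Lemma angle_gt0_ltpi m : (2 <= m)%N -> 0 < (pi : R) / m%:R < pi.
Proof.
move=> m2; have m0 : 0 < m%:R :> R by rewrite ltr0n (ltn_trans _ m2).
rewrite divr_gt0 ?pi_gt0 //= ltr_pdivrMr // ltr_pMr ?pi_gt0 //.
by rewrite ltr1n.
Qed.

Lemma adj_neq a b : adj a b -> a != b.
Proof. by apply: contraTneq => ->; rewrite adj_irr. Qed.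

Lemma coupling_adj a b : adj a b ->
  coupling a b = 2 * r * cos (pi / (lab a b)%:R).
Proof. by move=> ab; rewrite /coupling (negPf (adj_neq ab)) ab. Qed.

Lemma cheb_lab a b : adj a b -> cheb (coupling a b) (lab a b) = 0.
Proof.
move=> ab; have m2 := lab_ge2 ab.
have s0 := sin_gt0_pi (angle_gt0_ltpi m2).
have m0 : (lab a b)%:R != 0 :> R by rewrite pnatr_eq0 -lt0n (ltn_trans _ m2).
have := cheb_sin (pi / (lab a b)%:R) (lab a b).
rewrite -coupling_adj // [X in _ ^+ _ * sin X]mulrC divfK // sinpi mulr0 => /eqP.
by rewrite !mulf_eq0 (gt_eqF r_gt0) (gt_eqF s0) !orbF => /eqP.
Qed.

(** The block of couplings of a and b is invertible: with q = r^2, its determinant is (1 - q)^2 + 4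
    q sin^2 (pi / m) > 0. *)
Lemma coupling_nondeg a b : adj a b -> coupling a b ^+ 2 < (1 + r ^+ 2) ^+ 2.
Proof.
move=> ab; rewrite coupling_adj //; set t := _ / _.
have := sin_gt0_pi (angle_gt0_ltpi (lab_ge2 ab)); rewrite -/t => s0.
have q_s : 0 < r ^+ 2 * sin t ^+ 2 by rewrite mulr_gt0 ?exprn_gt0.
have -> : (1 + r ^+ 2) ^+ 2 = (2 * r * cos t) ^+ 2 + (1 - r ^+ 2) ^+ 2
  + 4 * (r ^+ 2 * sin t ^+ 2) by rewrite sin2cos2; ring.
have := sqr_ge0 (1 - r ^+ 2); lra.
Qed.

Lemma rstep_braid a b phi : adj a b ->
  run rstep (alt_word a b (lab a b)) phi = run rstep (alt_word b a (lab a b)) phi.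
Proof.
move=> ab; have nab := adj_neq ab; have U0 := cheb_lab ab.
(* The vertex is the next letter of the word starting with x and the last letter of the one starting
   with y; [cheb c m] = 0 makes the two values equal. Exchanging x and y gives the other vertex. *)
have key x y psi : adj x y -> run rstep (alt_word x y (lab x y)) psi
      (if odd (lab x y) then y else x) =
    run rstep (alt_word y x (lab x y)) psi (if odd (lab x y) then y else x).
  move=> xy; have nxy := adj_neq xy; have := cheb_lab xy.
  have := lab_ge2 xy; case: (lab x y) => [//|m] _ Um.
  rewrite run_alt_next // Um chebSS Um.
  have -> : (if odd m.+1 then y else x) = (if odd m then x else y).
    by rewrite /=; case: odd.
  by rewrite run_alt_last 1?eq_sym // [coupling y x]couplingC Um; ring.
have [P [Q PQ]] := run_alt_span a b (lab a b) phi.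
have [P' [Q' PQ']] := run_alt_span b a (lab a b) phi.
have eqa : run rstep (alt_word a b (lab a b)) phi a =
           run rstep (alt_word b a (lab a b)) phi a.
  have := key a b phi ab; have := key b a phi; rewrite [lab b a]lab_sym adj_sym.
  by case: odd => // /(_ ab) ->.
have eqb : run rstep (alt_word a b (lab a b)) phi b =
           run rstep (alt_word b a (lab a b)) phi b.
  have := key a b phi ab; have := key b a phi; rewrite [lab b a]lab_sym adj_sym.
  by case: odd => // /(_ ab) ->.
have caa d : coupling d d = - (1 + r ^+ 2) by rewrite /coupling eqxx.
move: eqa eqb; rewrite !PQ !PQ' [coupling b a]couplingC !caa => eqa eqb.
have nd := coupling_nondeg ab.
set c := coupling a b in nd eqa eqb; set q := 1 + r ^+ 2 in nd eqa eqb.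
(* Up to sign, the determinant of the linear system that [eqa] and [eqb] form in P - Q' and Q -
   P'. *)
have D0 : c ^+ 2 - q ^+ 2 != 0 by rewrite subr_eq0 lt_eqF.
have PQ0 : P = Q'.
  by apply: (mulfI D0); move: (congr1 ( *%R q) eqa) (congr1 ( *%R c) eqb); lra.
have QP0 : Q = P'.
  by apply: (mulfI D0); move: (congr1 ( *%R c) eqa) (congr1 ( *%R q) eqb); lra.
by apply/funext => d; rewrite PQ PQ' PQ0 QP0; ring.
Qed.

End Representation.

(** * Relations between two generators *)

Lemma alternate_rcons (T : Type) (x y : T) n :
  alternate x y n.+1 = rcons (alternate x y n) (if odd n then y else x).
Proof.
elim: n x y => [|n IHn] x y //.
by rewrite -[LHS]/(x :: alternate y x n.+1) IHn /=; case: odd.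
Qed.

Section Relations.
Variables (R : realType) (Γ : lgraph).
Local Open Scope ring_scope.
Implicit Types (a b s t : Γ) (S : set Γ).

Definition delta a : Γ -> R := fun b => (b == a)%:R.

Lemma rstep1_sign a e e' : rstep (1 : R) (a, e) =1 rstep 1 (a, e').
Proof.
by move=> phi; apply/funext => b; rewrite /rstep /= expr1n invr1; case: e; case: e'.
Qed.

Lemma run1_alternate s t e e' n phi :
  run (rstep (1 : R)) (alternate (s, e) (t, e') n) phi =
  run (rstep 1) (alt_word s t n) phi.
Proof.
elim: n s t e e' phi => //= n IHn s t e e' phi.
by rewrite (rstep1_sign s e true) IHn.
Qed.

(** At r = 1 the form [delta d] is fixed by every generator other than d, as it vanishes there,
    while d changes its value at d from 1 to -1. *)
Lemma parabolic_gen S d : parabolic S (gen d) -> S d.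
Proof.
move=> Sd; apply: contrapT => nSd.
have br : forall a b phi, adj a b -> _ := @rstep_braid R Γ 1 ltr01.
have can := @rstep_cancel R Γ 1 ltr01.
have : ract (rstep 1) (gen d) (delta d) = delta d.
  apply: (Sd [set g | ract (rstep 1) g (delta d) = delta d]).
  split; first exact: fixator_subgroup.
  move=> _ [c Sc <-] /=; rewrite ract_gen //; apply/funext => b.
  rewrite rstep_other /delta [X in _ * X](_ : _ = 0) ?mulr0 ?addr0 //.
  by case: eqP => // cd; rewrite -cd in nSd.
rewrite ract_gen // => /(congr1 (fun phi => phi d)).
by rewrite rstep_self /delta eqxx expr1n /=; lra.
Qed.

Lemma gen_neq1 a : gen a <> 1%g.
Proof.
move=> ga; suff: (@set0 Γ) a by [].
apply: parabolic_gen; rewrite ga => M [[]] //.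
Qed.

(** The case of an infinite label, where the coupling at r = 1 is 2: no [cheb] of positive index
    vanishes. *)
Lemma cheb1_nat n : cheb (1 : R) 2 n = n%:R.
Proof.
suff: cheb (1 : R) 2 n = n%:R /\ cheb (1 : R) 2 n.+1 = n.+1%:R by case.
elim: n => [//|n [IH1 IH2]]; split=> //.
by rewrite chebSS IH1 IH2 -addn2 -[n.+1]addn1 !natrD; ring.
Qed.

(** At r = 1 the signs of the letters are invisible, and the relation forces sin (m pi / m_st) = 0,
    which excludes 0 < m < m_st. *)
Lemma alternate_lab s t e e' m : (0 < m)%N -> s != t ->
  artin_class (alternate (s, e) (t, e') m) =
  artin_class (alternate (t, e') (s, e) m) ->
  adj s t /\ (lab s t <= m)%N.
Proof.
move=> m0 st /artin_classP eqv.
have br : forall a b phi, adj a b -> _ := @rstep_braid R Γ 1 ltr01.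
have can := @rstep_cancel R Γ 1 ltr01.
have := run_eqv can br (delta t) eqv; rewrite !run1_alternate => eqr.
(* Started from [delta t], the two words take the values U and -U at one and the same vertex, U
   being [cheb c m]. *)
have U0 : cheb (1 : R) (coupling 1 s t) m = 0.
  case: m m0 eqr {eqv} => // m _ /(congr1 (fun phi => phi (if odd m then s else t))).
  have {1}-> : (if odd m then s else t) = (if odd m.+1 then t else s).
    by rewrite /=; case: odd.
  rewrite run_alt_next // run_alt_last 1?eq_sym //.
  rewrite [coupling 1 t s]couplingC /delta eqxx (negPf st) expr1n.
  by move: (cheb 1 _ m.+1) => U /=; lra.
have [ab|nab] := boolP (adj s t); last first.
  move: U0; rewrite /coupling (negPf st) (negPf nab) mulr1 cheb1_nat.
  by move/eqP; rewrite pnatr_eq0 -leqn0 leqNgt m0.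
split=> //; rewrite leqNgt; apply/negP => ltm.
have n2 := lab_ge2 ab.
have /andP[th0 thpi] := angle_gt0_ltpi R n2.
have := cheb_sin (1 : R) (pi / (lab s t)%:R) m.
rewrite -coupling_adj // U0 mulr0 expr1n mul1r => /esym/eqP; rewrite gt_eqF //.
apply: sin_gt0_pi; rewrite mulr_gt0 ?ltr0n //= mulrCA gtr_pMr ?pi_gt0 //.
by rewrite ltr_pdivrMr ?mul1r ?ltr_nat // ltr0n (ltn_trans _ n2).
Qed.

Lemma gen_noncomm a b : adj a b -> (3 <= lab a b)%N ->
  (gen a * gen b <> gen b * gen a)%g.
Proof.
move=> ab lab3 ab_ba.
suff [] : adj a b /\ (lab a b <= 2)%N by rewrite leqNgt lab3.
apply: (@alternate_lab a b true true) => //; first exact: adj_neq.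
by rewrite (artin_classM [:: _] [:: _]) ab_ba -artin_classM.
Qed.

(* At r = 3 the product of s and t^-1 is hyperbolic on the plane of the values
   at s and t: a cone around the s-axis is mapped into itself. *)
Lemma alternate_sign s t n : adj s t -> (3 <= lab s t)%N ->
  artin_class (alternate (s, true) (t, false) n.+1) <>
  artin_class (alternate (t, false) (s, true) n.+1).
Proof.
move=> st lab3 /artin_classP eqv.
have nst := adj_neq st; have nts : t != s by rewrite eq_sym.
have r3 : 0 < 3 :> R by [].
have br : forall a b phi, adj a b -> _ := @rstep_braid R Γ 3 r3.
have can := @rstep_cancel R Γ 3 r3.
pose c := coupling (3 : R) s t.
have tt : coupling (3 : R) t t = - 10 by rewrite /coupling eqxx; lra.
(* A label of at least 3 gives cos (pi / m) > 0, and c = 2 r cos (pi / m) <= 2 r = 6. *)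
have [c0 c6] : 0 < c /\ c <= 6.
  rewrite /c coupling_adj //; set th := _ / _; have := cos_le1 th.
  suff : 0 < cos th by split; lra.
  apply: cos_gt0_pihalf; have /andP[th0 _] := angle_gt0_ltpi R (lab_ge2 st).
  rewrite (lt_trans _ th0) ?oppr_lt0 ?divr_gt0 ?pi_gt0 //= /th.
  by rewrite ltr_pM2l ?pi_gt0 // ltf_pV2 ?posrE ?ltr0n ?(ltn_trans _ lab3) // ltr_nat.
pose v k := run (rstep (3 : R)) (alternate (s, true) (t, false) k) (delta s).
have vS k : v k.+1 = rstep 3 (if odd k then (t, false) else (s, true)) (v k).
  by rewrite /v alternate_rcons /run foldl_rcons.
(* The nonzero coordinate is that of the letter applied next. The letter s widens the slope bound
   from c to 2c / 9; since 2 c^2 / 9 <= 8 < 9, the letter t^-1 brings it back below c. *)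
have cone k : if odd k then v k t != 0 /\ `|v k t| < 2 * c / 9 * `|v k s|
              else v k s != 0 /\ `|v k t| < c * `|v k s|.
  elim: k => [|k IHk].
    by rewrite /v /= /delta eqxx (negPf nts) normr0 normr1 oner_neq0; split=> //; lra.
  rewrite /= vS; move: IHk; case: (odd k) => /= -[nz lt].
    have -> : rstep 3 (t, false) (v k) t = - v k t / 9.
      by rewrite /rstep /= tt; field.
    have -> : rstep 3 (t, false) (v k) s = v k s + c / 9 * v k t.
      by rewrite /rstep /= [coupling 3 t s]couplingC -/c; field.
    set x := v k s in nz lt *; set y := v k t in nz lt *.
    have x0 : 0 < `|x|.
      rewrite lt_neqAle normr_ge0 andbT eq_sym; apply/eqP => e; move: lt.
      by rewrite e mulr0 ltNge normr_ge0.
    have y' : `|- y / 9| = `|y| / 9 by rewrite mulNr normrN normrM [`|_^-1|]ger0_norm ?invr_ge0.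
    have x' : `|x| - c / 9 * `|y| <= `|x + c / 9 * y|.
      by have := lerB_normD x (c / 9 * y); rewrite normrM [`|c / 9|]ger0_norm //; lra.
    have cy : c * `|y| <= c * (2 * c / 9 * `|x|) by rewrite ler_pM2l // ltW.
    have cc : c * (2 * c / 9 * `|x|) <= 8 * `|x|.
      have c2 : c * c <= 36 by nra.
      by have := ler_wpM2r (normr_ge0 x) c2; lra.
    have lx : `|x| / 9 <= `|x + c / 9 * y| by lra.
    have cx : c * (`|x| / 9) <= c * `|x + c / 9 * y| by rewrite ler_pM2l.
    split; first by rewrite -normr_gt0; lra.
    rewrite y'; have : c * `|x| > 0 by rewrite mulr_gt0.
    lra.
  have -> : rstep 3 (s, true) (v k) s = - 9 * v k s.
    by rewrite rstep_self; ring.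
  rewrite rstep_other -/c.
  set x := v k s in nz lt *; set y := v k t in nz lt *.
  have cx : `|c * x| = c * `|x| by rewrite normrM gtr0_norm.
  have x' : `|- 9 * x| = 9 * `|x| by rewrite mulNr normrN normrM [`|9|]ger0_norm.
  split; last by have := ler_normD y (c * x); rewrite cx x'; lra.
  rewrite addr_eq0; apply/eqP => e; move: lt.
  by rewrite e normrN cx ltxx.
have := run_eqv can br (delta s) eqv; rewrite -/(v n.+1) vS.
(* The letter t^-1 fixes [delta s], so the relation says that the letter following [v n] fixes
   [v n]. That letter multiplies its own coordinate by -9 or -1/9, so this coordinate would
   vanish. *)
have -> : run (rstep (3 : R)) (alternate (t, false) (s, true) n.+1) (delta s) = v n.
  rewrite /v [LHS]/=; congr run; apply/funext => b.
  by rewrite /rstep /= {2}/delta (negPf nts) mulr0 mul0r addr0.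
move=> fixv; move: (cone n) fixv; case: (odd n) => -[/eqP nz _].
  by move/(congr1 (fun phi => phi t)); rewrite /rstep /= tt => e; apply: nz; lra.
by move/(congr1 (fun phi => phi s)); rewrite rstep_self => e; apply: nz; lra.
Qed.

End Relations.

(** * The degree homomorphism to the integers *)

Section Degree.
Variable Γ : lgraph.
Implicit Types (a b : Γ) (g h : artin Γ).

Definition deg_step (l : Γ * bool) (z : int) : int :=
  (z + (if l.2 then 1 else -1))%R.

Lemma deg_step_cancel a e z : deg_step (a, ~~ e) (deg_step (a, e) z) = z.
Proof. by rewrite /deg_step; case: e => /=; ring. Qed.

Lemma deg_step_alt a b n z : run deg_step (alt_word a b n) z = (z + n%:Z)%R.
Proof.
by elim: n a b z => [|n IHn] a b z /=; rewrite ?addr0 // IHn /deg_step -addn1 PoszD /=; ring.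
Qed.

Lemma deg_step_braid a b z : adj a b ->
  run deg_step (alt_word a b (lab a b)) z = run deg_step (alt_word b a (lab a b)) z.
Proof. by rewrite !deg_step_alt. Qed.

Definition degree g : int := ract deg_step g 0%R.

Let ractM' := ractM deg_step_cancel deg_step_braid.

Lemma degree_gen a : degree (gen a) = 1%R.
Proof. exact: (ract_gen deg_step_cancel deg_step_braid). Qed.

Lemma ract_degree g z : ract deg_step g z = (z + degree g)%R.
Proof.
have genV a y : ract deg_step (gen a)^-1 y = (y - 1)%R.
  rewrite -{1}[y](subrK 1%R) -[X in ract _ _ X](ract_gen deg_step_cancel deg_step_braid a).
  by rewrite (ractVK deg_step_cancel deg_step_braid).
have genE a y : ract deg_step (gen a) y = (y + 1)%R.
  exact: (ract_gen deg_step_cancel deg_step_braid).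
rewrite /degree; elim/artin_ind: g z => [|a g IHg|a g IHg] z.
- by rewrite !(ract1 deg_step_cancel deg_step_braid) addr0.
- by rewrite !ractM' !genE IHg [in RHS]IHg; ring.
- by rewrite !ractM' !genV IHg [in RHS]IHg; ring.
Qed.

Lemma degreeM g h : degree (g * h) = (degree g + degree h)%R.
Proof. by rewrite {1}/degree ractM' ract_degree. Qed.

Lemma degree1 : degree 1 = 0%R.
Proof. exact: (ract1 deg_step_cancel deg_step_braid). Qed.

Lemma degreeV g : degree g^-1 = (- degree g)%R.
Proof. by apply/eqP; rewrite -addr_eq0 -degreeM mulVg degree1. Qed.

Lemma degreeX g n : degree (g ^+ n) = (n%:Z * degree g)%R.
Proof.
elim: n => [|n IHn]; first by rewrite degree1 mul0r.
by rewrite expgS degreeM IHn -addn1 PoszD; ring.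
Qed.

End Degree.

(** * Generated subgroups and automorphisms *)

Section Subgroups.
Variable G : groupType.
Implicit Types (x y : G) (S H : set G).

Lemma gen_subgroup_closed S : subgroup_closed (gen_subgroup S).
Proof.
split=> [M [[M1 _ _] _] //|x y Sx Sy M MS|x Sx M MS].
  by have [[_ MM _] _] := MS; apply: MM; [apply: Sx | apply: Sy].
by have [[_ _ MV] _] := MS; apply: MV; apply: Sx.
Qed.

Lemma sub_gen_subgroup S : S `<=` gen_subgroup S.
Proof. by move=> x Sx M [_ SM]; apply: SM. Qed.

Lemma gen_subgroup_min S H : subgroup_closed H -> S `<=` H -> gen_subgroup S `<=` H.
Proof. by move=> Hc SH x; apply. Qed.

Lemma gen_subgroup1 x y : gen_subgroup [set x] y ->
  exists n, y = x ^+ n \/ y = (x ^+ n)^-1.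
Proof.
apply: (@gen_subgroup_min _ [set y | exists n, y = x ^+ n \/ y = (x ^+ n)^-1]);
  last by move=> _ ->; exists 1%N; left.
have mixed m n : exists k, x ^+ m * (x ^+ n)^-1 = x ^+ k \/
    x ^+ m * (x ^+ n)^-1 = (x ^+ k)^-1.
  have [nm|mn] := leqP n m.
    by exists (m - n)%N; left; rewrite expgnFr.
  by exists (n - m)%N; right; rewrite expgnFr 1?ltnW // invgM invgK.
split=> /= [|y1 y2 [m ym] [n yn]|y1 [m ym]]; first by exists 0%N; left.
- case: ym yn => -> [] ->; last 1 first.
  + by exists (n + m)%N; right; rewrite expgnDr invgM.
  + by exists (m + n)%N; left; rewrite expgnDr.
  + exact: mixed.
  have <- : x ^+ n * (x ^+ m)^-1 = (x ^+ m)^-1 * x ^+ n; last exact: mixed.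
  by apply: commuteV; apply: commuteX2.
- by case: ym => ->; exists m; [right | left; rewrite invgK].
Qed.

Lemma aut1 (p : aut G) : p 1 = 1.
Proof. by apply: (mulgI (p 1)); rewrite -autM !mulg1. Qed.

Lemma autV (p : aut G) x : p x^-1 = (p x)^-1.
Proof. by apply: (mulgI (p x)); rewrite -autM !mulgV aut1. Qed.

Lemma autX (p : aut G) x n : p (x ^+ n) = p x ^+ n.
Proof. by elim: n => [|n IHn]; rewrite ?aut1 // !expgS autM IHn. Qed.

Definition conj_fun (g h : G) : G := g * h * g^-1.

Lemma conj_funM g : {morph conj_fun g : x y / x * y}.
Proof. by move=> x y; rewrite /conj_fun !mulgA mulgVK. Qed.

Lemma conj_funK g : cancel (conj_fun g) (conj_fun g^-1).
Proof. by move=> x; rewrite /conj_fun invgK !mulgA mulVg mul1g mulgVK. Qed.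

Lemma conj_funVK g : cancel (conj_fun g^-1) (conj_fun g).
Proof. by move=> x; rewrite -{1}[g]invgK conj_funK. Qed.

Definition conj_aut (g : G) : aut G :=
  Aut (@conj_funM g) (Bijective (@conj_funK g) (@conj_funVK g)).

End Subgroups.

(** * The global inversion *)

Section Inversion.
Variable Γ : lgraph.
Implicit Types (a b : Γ) (g h : artin Γ).

Lemma letterN a e : letter (a, ~~ e) = (letter (a, e))^-1.
Proof. by case: e; rewrite !letterE //= invgK. Qed.

(** Inverting reverses the word, so its first letter depends on the parity of n. *)
Lemma alternate_inv a b n :
  (artin_class (alternate (a, false) (b, false) n))^-1 =
  if odd n then artin_class (alternate (a, true) (b, true) n)
  else artin_class (alternate (b, true) (a, true) n).
Proof.
elim: n a b => [|n IHn] a b; first by apply: invg1.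
rewrite [LHS]/= artin_class_cons invgM IHn (letterN a true) invgK.
rewrite [odd n.+1]/= if_neg !alternate_rcons -cats1 -cats1 !artin_classM.
by case: odd.
Qed.

(** A letter acts on the group itself by right multiplication by its inverse; the inversion of g is
    then the image of 1 under g. *)
Definition inv_step (l : Γ * bool) (g : artin Γ) : artin Γ := g * letter (l.1, ~~ l.2).

Lemma inv_step_cancel a e g : inv_step (a, ~~ e) (inv_step (a, e) g) = g.
Proof. by rewrite /inv_step /= negbK letterN mulgVK. Qed.

Lemma inv_step_alt a b n g : run inv_step (alt_word a b n) g =
  g * artin_class (alternate (a, false) (b, false) n).
Proof.
elim: n a b g => [|n IHn] a b g /=; first by rewrite -[RHS]/(g * 1) mulg1.
by rewrite IHn /inv_step artin_class_cons mulgA.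
Qed.

Lemma inv_step_braid a b g : adj a b ->
  run inv_step (alt_word a b (lab a b)) g = run inv_step (alt_word b a (lab a b)) g.
Proof.
move=> ab; rewrite !inv_step_alt; congr (_ * _); apply: invg_inj.
rewrite !alternate_inv -!alt_wordE.
by have /artin_classP -> := artin_braid ab; rewrite if_same.
Qed.

Let ract_genI := ract_gen inv_step_cancel inv_step_braid.
Let ractMI := ractM inv_step_cancel inv_step_braid.

Definition inversion g : artin Γ := ract inv_step g 1.

Lemma ract_inversion g h : ract inv_step g h = h * inversion g.
Proof.
have genE a y : ract inv_step (gen a) y = y * (gen a)^-1.
  by rewrite ract_genI /inv_step letterE.
have genV a y : ract inv_step (gen a)^-1 y = y * gen a.
  rewrite -{1}[y](mulgK (gen a)) -genE (ractVK inv_step_cancel inv_step_braid) //.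
rewrite /inversion; elim/artin_ind: g h => [|a g IHg|a g IHg] h.
- by rewrite !(ract1 inv_step_cancel inv_step_braid) mulg1.
- by rewrite !ractMI !genE IHg [in RHS]IHg !mulgA mulg1.
- by rewrite !ractMI !genV IHg [in RHS]IHg !mulgA mulg1.
Qed.

Lemma inversionM : {morph inversion : g h / g * h}.
Proof. by move=> g h; rewrite {1}/inversion ractMI ract_inversion. Qed.

Lemma inversion_gen a : inversion (gen a) = (gen a)^-1.
Proof. by rewrite /inversion ract_genI /inv_step mul1g letterE. Qed.

Lemma inversion1 : inversion 1 = 1.
Proof. exact: (ract1 inv_step_cancel inv_step_braid). Qed.

Lemma inversionV g : inversion g^-1 = (inversion g)^-1.
Proof. by apply: (mulgI (inversion g)); rewrite -inversionM !mulgV inversion1. Qed.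

Lemma inversionK : involutive inversion.
Proof.
elim/artin_ind => [|a g IHg|a g IHg]; first by rewrite !inversion1.
  by rewrite !inversionM inversion_gen inversionV inversion_gen invgK IHg.
by rewrite !inversionM !inversionV inversion_gen inversionV inversion_gen invgK IHg.
Qed.

Definition inversion_aut : aut (artin Γ) :=
  Aut inversionM (Bijective inversionK inversionK).

End Inversion.

Arguments inversion_aut : clear implicits.

(** * Automorphisms permuting the generators up to sign and conjugation *)

Section StandardGenerators.
Variables (R : realType) (Γ : lgraph).
Implicit Types (a b c : Γ) (psi : aut (artin Γ)).


Lemma aut_alternate psi (s : Γ -> Γ) (e : Γ -> bool) a b n :
  (forall a, psi (gen a) = letter (s a, e a)) ->
  psi (artin_class (alternate (a, true) (b, true) n)) =
  artin_class (alternate (s a, e a) (s b, e b) n).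
Proof.
move=> psiE; elim: n a b => [|n IHn] a b; first exact: aut1.
by rewrite /= !artin_class_cons autM IHn letterE psiE.
Qed.

(** The automorphism turns the braid relation of a and b into a relation of the same length between
    signed generators. This bounds the new label from one side; the other bound comes from the
    inverse automorphism. *)
Lemma aut_adj psi (s : Γ -> Γ) (e : Γ -> bool) a b :
  (forall a, psi (gen a) = letter (s a, e a)) -> injective s -> adj a b ->
  [/\ adj (s a) (s b), (lab (s a) (s b) <= lab a b)%N &
      (3 <= lab (s a) (s b))%N -> e a = e b].
Proof.
move=> psiE s_inj ab; have := lab_ge2 ab.
have /artin_classP := artin_braid ab; rewrite !alt_wordE.
move=> /(congr1 psi); rewrite !(aut_alternate _ _ _ psiE).
case: (lab a b) => // m rel m1.
have [|sab le] := alternate_lab R (ltn0Sn m) _ rel.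
  by rewrite (inj_eq s_inj) adj_neq.
split=> // lab3; move: rel; case: (e a); case: (e b) => // rel.
  by have := alternate_sign R sab lab3 rel.
by case: (alternate_sign R (s := s b) (t := s a) (n := m)); rewrite 1?adj_sym 1?lab_sym.
Qed.

Lemma aut_standard psi (s : Γ -> Γ) (e : Γ -> bool) :
  large_type Γ -> connected_graph Γ -> injective s ->
  (forall a, psi (gen a) = letter (s a, e a)) -> Aut_graph Γ psi.
Proof.
move=> large conn s_inj psiE.
have e_adj a b : adj a b -> e a = e b.
  move=> ab; have [sab _] := aut_adj psiE s_inj ab; apply; exact: large.
have e_const a b : e a = e b.
  have /connectP [q path_q ->] := conn a b.
  elim: q a path_q => //= c q IHq a /andP[/e_adj -> /IHq]; exact.
pose sp := perm s_inj.
have spE : sp =1 s by exact: permE.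
pose psi' : aut (artin Γ) := psi^-1.
have psi'K : cancel psi psi'.
  by move=> x; rewrite -[LHS]/((psi' * psi : aut _) x) mulVg.
(* The inverse has the same form, with s inverted, so [aut_adj] applies to it as well. *)
have psi'E a : psi' (gen a) = letter ((sp^-1)%g a, e ((sp^-1)%g a)).
  apply: (can_inj (f := psi) (g := psi')) => //.
  rewrite -[LHS]/((psi * psi' : aut _) _) mulgV letterE /=.
  have : psi (gen ((sp^-1)%g a)) = letter (a, e ((sp^-1)%g a)).
    by rewrite psiE -spE permKV.
  by case: (e _); rewrite letterE /= => psia; rewrite ?autV psia ?invgK.
have sp_label : label_preserving sp.
  have adjs a b : adj a b -> adj (sp a) (sp b).
    by move=> ab; rewrite !spE; have [] := aut_adj psiE s_inj ab.
  have adjV a b : adj (sp a) (sp b) -> adj a b /\ (lab a b <= lab (sp a) (sp b))%N.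
    by move=> /(aut_adj psi'E perm_inj)[]; rewrite !permK.
  split=> a b; first by apply/idP/idP => [/adjV[]|/adjs].
  move=> ab; apply/eqP; rewrite eqn_leq.
  have [_ ->] := adjV _ _ (adjs _ _ ab).
  by rewrite !spE andbT; have [] := aut_adj psiE s_inj ab.
have [e1|e0] : (forall a, e a = true) \/ (forall a, e a = false).
  case: (pickP (mem Γ)) => [a _|no]; last by left => a; have := no a.
  by case ea: (e a); [left|right] => b; rewrite -ea.
  apply: sub_gen_subgroup; left; right; exists sp; split=> // a.
  by rewrite psiE letterE /= e1 spE.
(* When all signs are negative, composing with the global inversion leaves a graph automorphism. *)
have -> : psi = (psi * inversion_aut Γ) * inversion_aut Γ.
  by apply: autP => g /=; rewrite inversionK.
have [_ clM _] := gen_subgroup_closed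
  (@inner_auts Γ `|` @graph_auts Γ `|` @global_inversions Γ).
apply: clM; apply: sub_gen_subgroup; last by right=> a; exact: inversion_gen.
left; right; exists sp; split=> // a.
by rewrite /= inversion_gen autV psiE letterE /= e0 invgK spE.
Qed.

Lemma parabolicS (S S' : set Γ) : parabolic S `<=` parabolic S' -> S `<=` S'.
Proof.
move=> SS' a Sa; apply: (parabolic_gen R); apply: SS'.
by apply: sub_gen_subgroup; exists a.
Qed.

Lemma parabolic_genP (S : set Γ) a : S a -> parabolic S (gen a).
Proof. by move=> Sa; apply: sub_gen_subgroup; exists a. Qed.

Lemma parabolic_set1 a : parabolic [set a] (gen a).
Proof. by apply: (@parabolic_genP [set a]). Qed.

Lemma cyclic_parabolic a (h : artin Γ) : parabolic [set a] h ->
  exists n, h = gen a ^+ n \/ h = (gen a ^+ n)^-1.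
Proof. by rewrite /parabolic image_set1; apply: gen_subgroup1. Qed.

(** Up to inversion psi(a) is c^k, and c is in turn psi(a)^n; comparing degrees gives n k = 1, so k
    = 1. *)
Lemma aut_cyclic psi :
  large_type Γ -> connected_graph Γ ->
  (forall a, exists c, forall h, parabolic [set a] h <-> parabolic [set c] (psi h)) ->
  Aut_graph Γ psi.
Proof.
move=> large conn cyc.
have [s sP] := choice cyc.
have s_inj : injective s.
  move=> a b sab; suff: [set b] a by [].
  apply: (parabolic_gen R).
  by apply: (sP b _).2; rewrite -sab; apply: (sP a _).1; exact: parabolic_set1.
have gens a : exists e, psi (gen a) = letter (s a, e).
  have /(sP a _).1/cyclic_parabolic[k psik] : parabolic [set a] (gen a).
    exact: parabolic_set1.
  have [q psiK qK] := aut_bij psi.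
  have /cyclic_parabolic[n qn] : parabolic [set a] (q (gen (s a))).
    by apply: (sP a _).2; rewrite qK; exact: parabolic_set1.
  have sn : gen (s a) = psi (gen a) ^+ n \/ gen (s a) = (psi (gen a) ^+ n)^-1.
    by rewrite -[X in X = _ \/ X = _]qK; case: qn => ->; rewrite ?autV autX; [left|right].
  have k1 : k = 1%N.
    have : `|degree (gen (s a))|%N = (n * k)%N.
      case: sn => ->; rewrite ?degreeV ?abszN degreeX abszM;
      by case: psik => ->; rewrite ?degreeV ?abszN degreeX degree_gen abszM muln1.
    by rewrite degree_gen /= => /esym/eqP; rewrite muln_eq1 => /andP[_ /eqP].
  by case: psik => ->; [exists true|exists false]; rewrite k1 expg1 letterE.
have [e eP] := choice gens.
exact: aut_standard s_inj eP.
Qed.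

Lemma aut_conj_cyclic psi g :
  large_type Γ -> connected_graph Γ ->
  (forall a, exists c, forall h,
     parabolic [set a] h <-> parabolic [set c] (g^-1 * psi h * g)) ->
  Aut_graph Γ psi.
Proof.
move=> large conn cyc.
have [_ clM _] := gen_subgroup_closed
  (@inner_auts Γ `|` @graph_auts Γ `|` @global_inversions Γ).
have -> : psi = conj_aut g * (conj_aut g^-1 * psi).
  by apply: autP => h; rewrite /= conj_funVK.
apply: clM; first by apply: sub_gen_subgroup; left; left; exists g.
apply: aut_cyclic => // a; have [c cP] := cyc a.
by exists c => h; rewrite cP /= /conj_fun invgK.
Qed.

End StandardGenerators.

(** * Cosets of parabolic subgroups *)

Section Cosets.
Variables (R : realType) (Γ : lgraph).
Implicit Types (a b : Γ) (g h : artin Γ) (S : set Γ) (B : set (artin Γ)).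

Lemma dcosetP g S h : dcoset g S h <-> parabolic S (g^-1 * h).
Proof.
split=> [[k Sk <-]|Sgh]; first by rewrite mulKg.
by exists (g^-1 * h) => //; rewrite mulVKg.
Qed.

Lemma dcoset_refl g S : dcoset g S g.
Proof. by apply/dcosetP; rewrite mulVg; have [] := gen_subgroup_closed (@gen Γ @` S). Qed.

Lemma dcoset_eq g h S : dcoset g S h -> dcoset g S = dcoset h S.
Proof.
have [_ SM SV] := gen_subgroup_closed (@gen Γ @` S).
move=> /dcosetP Sgh; apply/seteqP; split=> k /dcosetP Sk; apply/dcosetP.
  have -> : h^-1 * k = (g^-1 * h)^-1 * (g^-1 * k) by rewrite invgM invgK -mulgA mulVKg.
  by apply: SM => //; apply: SV.
have -> : g^-1 * k = (g^-1 * h) * (h^-1 * k) by rewrite -mulgA mulVKg.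
exact: SM.
Qed.

Lemma parabolic0 h : parabolic set0 h -> h = 1.
Proof.
apply: (@gen_subgroup_min _ _ [set 1]); last by move=> _ [a []].
by split=> //= [x y -> ->|x ->]; rewrite ?mulg1 ?invg1.
Qed.

(** In particular a coset determines its type S. *)
Lemma dcoset_sub g h S S' : dcoset g S `<=` dcoset h S' -> S `<=` S'.
Proof.
move=> sub; have := sub _ (dcoset_refl g S) => /dcoset_eq eqd.
rewrite eqd in sub; apply: (parabolicS R) => k Sk.
by have /sub/dcosetP : dcoset g S (g * k); [exists k | rewrite mulKg].
Qed.

Lemma lcoset_dcoset h g S : lcoset_set h (dcoset g S) = dcoset (h * g) S.
Proof. by rewrite /dcoset lcosetM. Qed.

Lemma parabolic_set1_comm a h k :
  parabolic [set a] h -> parabolic [set a] k -> commute h k.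
Proof.
move=> /cyclic_parabolic[m hm] /cyclic_parabolic[n kn].
have c := commuteX2 m n (commute_refl (gen a)).
case: hm kn => -> [] -> //.
- exact: commuteV.
- exact/commute_sym/commuteV/commute_sym.
- exact/commuteV/commute_sym/commuteV/commute_sym.
Qed.

End Cosets.

(** * Stabilizers of points of the Deligne complex *)

Section Stabilizers.
Variables (R : realType) (Γ : lgraph).
Implicit Types (a b : Γ) (g h : artin Γ) (S : set Γ) (B : set (artin Γ)).
Implicit Types (x y : deligne Γ R).

Lemma bary_sum_seq x (s : seq (set (artin Γ))) :
  uniq s -> supported x [set` s] -> (\sum_(B <- s) x B = 1)%R.
Proof.
move=> us xs; rewrite -(bary_sum x) fsbig_seq //; apply: fsbig_widen => // B [_ nB] /=.
by apply/eqP/negPn/negP => /xs.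
Qed.

Lemma bary_supp x : exists B, x B != 0%R.
Proof.
apply: contrapT => no; have /eqP := bary_sum x.
rewrite fsbig1 ?(eq_sym 0%R) ?oner_eq0 // => B _.
by apply/eqP/negPn/negP => nz; apply: no; exists B.
Qed.

(* Cosets of a chain are compared through the cardinals of their types. *)
Lemma min_vertex x : exists g S, [/\ deligne_type S, x (dcoset g S) != 0%R &
  forall B, x B != 0%R -> dcoset g S `<=` B].
Proof.
pose T S : {set Γ} := [set a | `[< S a >]]%SET.
pose P n := `[< exists g S, [/\ deligne_type S, x (dcoset g S) != 0%R & #|T S| = n] >].
have exP : exists n, P n.
  have [B nz] := bary_supp x; have [g [S [tS eqB]]] := bary_vertex nz.
  by exists #|T S|; apply/asboolP; exists g, S; rewrite -eqB.
case: (ex_minnP exP) => n /asboolP [g [S [tS nzS cS]]] nmin.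
exists g, S; split=> // B nzB; have [//|sub] := bary_chain nzS nzB.
have [g' [S' [tS' eqB]]] := bary_vertex nzB; rewrite eqB in sub nzB *.
have S'S := dcoset_sub R sub.
have TS : T S' = T S.
  apply/eqP; rewrite eqEcard cS nmin ?andbT; last by apply/asboolP; exists g', S'.
  by apply/fintype.subsetP => a; rewrite !inE; exact: S'S.
have {}S'S : S' = S.
  apply/seteqP; split=> // a Sa; have : a \in T S' by rewrite TS !inE.
  by rewrite !inE.
by rewrite S'S in sub *; rewrite (dcoset_eq (sub _ (dcoset_refl g' S))).
Qed.

(** An h fixing x moves the smallest coset of the support to a coset of the support, which contains
    it. Conversely, for h in g A_S g^-1, each coset of the support contains both g and hg, so h
    fixes it. *)
Lemma stabilizerP x g S h : x (dcoset g S) != 0%R ->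
  (forall B, x B != 0%R -> dcoset g S `<=` B) ->
  deligne_act h x = x <-> parabolic S (g^-1 * h * g).
Proof.
move=> nz sub; have [_ SM SV] := gen_subgroup_closed (@gen Γ @` S); split=> [hx|Sh].
  have : x (lcoset_set h (dcoset g S)) != 0%R.
    by rewrite -hx /= /act_bary lcosetK.
  move=> /sub; rewrite lcoset_dcoset => /(_ _ (dcoset_refl g S))/dcosetP.
  by move=> /SV; rewrite invgM invgK mulgA.
have fixB B : x B != 0%R -> lcoset_set h B = B.
  move=> nzB; have [g' [S' [_ eqB]]] := bary_vertex nzB.
  have /dcoset_eq eqg : dcoset g' S' g by rewrite -eqB; apply: sub nzB _ (dcoset_refl g S).
  have /dcoset_eq eqh : dcoset g S' (h * g).
    by rewrite -eqg -eqB; apply: sub nzB _ _; apply/dcosetP; rewrite mulgA.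
  by rewrite eqB eqg lcoset_dcoset -eqh.
apply: deligneP => B; rewrite /= /act_bary.
have [x0|nzB] := eqVneq (x B) 0%R; last by rewrite -[in LHS](fixB B nzB) lcosetK.
have [x0'|nzB'] := eqVneq (x (lcoset_set h^-1 B)) 0%R; first by rewrite x0 x0'.
by rewrite -(fixB _ nzB') lcosetVK.
Qed.

End Stabilizers.

(** * Barycentric coordinates are Lipschitz *)

Section Metric.
Variables (R : realType) (Γ : lgraph).
Local Open Scope ring_scope.
Implicit Types (a b : Γ) (g h : artin Γ) (S : set Γ) (B : set (artin Γ)).
Implicit Types (x y : deligne Γ R).

(** The angle pi / 2m is at most pi / 4. Hence the factor [cotan] in [triangle_dist] only enlarges
    differences of coordinates. *)
Lemma cotan_ge1 m : (2 <= m)%N -> 1 <= cotan (pi / (2 * m%:R) : R).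
Proof.
move=> m2; set t := _ / _.
have m2R : 2 <= m%:R :> R by rewrite ler_nat.
have pi0 := pi_gt0 R.
have t0 : 0 < t by rewrite divr_gt0 // mulr_gt0 //; lra.
have t4 : t <= pi / 4.
  by rewrite ler_pM2l // lef_pV2 ?posrE; lra.
have s0 : 0 < sin t by apply: sin_gt0_pihalf; lra.
rewrite /cotan ler_pdivlMr // mul1r -[cos t]cosN -sinDpihalf leNgt.
by rewrite ltr_sin ?in_itv /=; [rewrite -leNgt; lra | apply/andP; split; lra ..].
Qed.

Lemma dcoset_neq g S S' : ~ S' `<=` S -> dcoset g S != dcoset g S'.
Proof.
move=> nS; apply/eqP => e; apply: nS.
by apply: (dcoset_sub R (g := g) (h := g)); rewrite e.
Qed.

(** In a triangle the coordinates at the cosets of types [set0] and [[set a; b]] vary by at most l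
    each; the third one is 1 minus their sum, whence the factor 2. *)
Lemma simplex_dist_bary x y l B : simplex_dist x y l -> `|x B - y B| <= 2 * l.
Proof.
have outside s (z : deligne Γ R) : supported z s -> ~ s B -> z B = 0.
  by move=> zs sB; apply/eqP/negPn/negP => /zs.
case=> [g a b ab xs ys|g a xs ys].
  set D0 := dcoset g set0 in xs ys *; set D1 := dcoset g [set a] in xs ys *.
  set D2 := dcoset g [set a; b] in xs ys *.
  have D01 : D0 != D1 by apply: dcoset_neq => /(_ a erefl).
  have D02 : D0 != D2 by apply: dcoset_neq => /(_ a (or_introl erefl)).
  have D12 : D1 != D2.
    apply: dcoset_neq => /(_ b (or_intror erefl)) ba.
    by have := adj_neq ab; rewrite ba eqxx.
  have sum1 (z : deligne Γ R) : supported z [set D0; D1; D2] -> z D1 = 1 - z D0 - z D2.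
    move=> zs; rewrite -(@bary_sum_seq R Γ z [:: D0; D1; D2]).
    - by rewrite !big_cons big_nil; ring.
    - by rewrite /= !inE negb_or D01 D02 D12.
    - by move=> C /zs /= [[]|] ->; rewrite !inE eqxx ?orbT.
  rewrite /triangle_dist -/D0 -/D2.
  have := cotan_ge1 (lab_ge2 ab); set k := cotan _ => k1.
  set u := x D0 - y D0; set v := x D2 - y D2.
  have lu : `|u| <= Num.sqrt (u ^+ 2 + (k * v) ^+ 2).
    by rewrite -sqrtr_sqr ler_wsqrtr // lerDl sqr_ge0.
  have lv : `|v| <= Num.sqrt (u ^+ 2 + (k * v) ^+ 2).
    have kv : `|v| <= `|k * v|.
      by rewrite normrM [`|k|]ger0_norm ?ler_peMl //; lra.
    by apply: le_trans kv _; rewrite -sqrtr_sqr ler_wsqrtr // lerDr sqr_ge0.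
  have l0 := sqrtr_ge0 (u ^+ 2 + (k * v) ^+ 2).
  have [[[->|->]|->]|out] := pselect ([set D0; D1; D2] B).
  - rewrite -/u; lra.
  - have -> : x D1 - y D1 = - (u + v) by rewrite !sum1 // /u /v; ring.
    by rewrite normrN; have := ler_normD u v; lra.
  - rewrite -/v; lra.
  - by rewrite (outside _ _ xs out) (outside _ _ ys out) subr0 normr0; lra.
set D0 := dcoset g set0 in xs ys *; set D1 := dcoset g [set a] in xs ys *.
have D01 : D0 != D1 by apply: dcoset_neq => /(_ a erefl).
have sum1 (z : deligne Γ R) : supported z [set D0; D1] -> z D1 = 1 - z D0.
  move=> zs; rewrite -(@bary_sum_seq R Γ z [:: D0; D1]).
  - by rewrite !big_cons big_nil; ring.
  - by rewrite /= !inE D01.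
  - by move=> C /zs /= [] ->; rewrite !inE eqxx ?orbT.
have l0 := normr_ge0 (x D0 - y D0).
have [[->|->]|out] := pselect ([set D0; D1] B).
- lra.
- have -> : x D1 - y D1 = - (x D0 - y D0) by rewrite !sum1 //; ring.
  rewrite normrN; lra.
- by rewrite (outside _ _ xs out) (outside _ _ ys out) subr0 normr0; lra.
Qed.

Lemma string_length_bary x y l B : string_length x y l -> `|x B - y B| <= 2 * l.
Proof.
elim=> [z|{}x {}y z l1 l2 /(simplex_dist_bary B) d1 _ d2].
  by rewrite subrr normr0 mulr0.
have -> : x B - z B = (x B - y B) + (y B - z B) by ring.
by apply: le_trans (ler_normD _ _) _; lra.
Qed.

Lemma deligne_dist_bary x y (d : R) B :
  (deligne_dist x y <= d%:E)%E -> `|x B - y B| <= 2 * d.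
Proof.
move=> xyd; suff : ((`|x B - y B| / 2)%:E <= d%:E)%E by rewrite lee_fin; lra.
apply: le_trans xyd; apply: le_ereal_inf_tmp => _ [l /(string_length_bary B) xyl <-].
by rewrite lee_fin; lra.
Qed.

(** Truncation to [0, 1] makes the edge below a path defined on all of R, so that openness can be
    stated in R. *)
Definition clamp (t : R) : R := Num.max 0 (Num.min 1 t).

Lemma clamp_itv t : 0 <= clamp t <= 1.
Proof. by rewrite /clamp le_max lexx /= ge_max ler01 ge_min lexx. Qed.

Lemma clamp_id t : 0 <= t <= 1 -> clamp t = t.
Proof. by move=> /andP[t0 t1]; rewrite /clamp min_r // max_r. Qed.

Lemma clamp_lipschitz s t : `|clamp s - clamp t| <= `|s - t|.
Proof.
rewrite /clamp /Num.max /Num.min.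
have := ler_norm (s - t); have := ler_norm (t - s); rewrite (distrC t s) => st ts.
rewrite ler_norml; apply/andP.
by case: (ltP 1 s) => ?; case: (ltP 1 t) => ?; rewrite ?ltr01;
  case: (ltP 0 s) => ?; case: (ltP 0 t) => ?; split; lra.
Qed.

(** * The edge from the vertex {1} to the vertex of a *)

Section Edge.
Variable a : Γ.

(** The parameter is the weight of {1}: t = 1 is the vertex {1} and t = 0 the vertex <a>. *)
Definition edge_bary (t : R) B : R :=
  if B == dcoset 1%g set0 then clamp t
  else if B == dcoset 1%g [set a] then 1 - clamp t else 0.

Lemma edge_supp t B : edge_bary t B != 0 ->
  B = dcoset 1%g set0 \/ B = dcoset 1%g [set a].
Proof.
rewrite /edge_bary; case: (B =P dcoset 1%g set0) => [->|_]; first by left.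
by case: (B =P dcoset 1%g [set a]) => [->|_]; [right | rewrite eqxx].
Qed.

Lemma edge_vertex t B : edge_bary t B != 0 -> deligne_vertex B.
Proof.
move=> /edge_supp[] eqB; [exists 1%g, set0 | exists 1%g, [set a]]; split=> //.
  by constructor.
by constructor 2; exists a.
Qed.

Lemma dcoset0_sub g S : dcoset g set0 `<=` dcoset g S.
Proof.
move=> h /dcosetP /parabolic0 e; apply/dcosetP; rewrite e.
by have [] := gen_subgroup_closed (@gen Γ @` S).
Qed.

Lemma edge_chain t B C : edge_bary t B != 0 -> edge_bary t C != 0 ->
  B `<=` C \/ C `<=` B.
Proof.
have sub := @dcoset0_sub 1%g [set a].
by move=> /edge_supp[] eB /edge_supp[] eC; rewrite eB eC; [left|left|right|left].
Qed.

Lemma edge_ge0 t B : 0 <= edge_bary t B.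
Proof.
have /andP[t0 t1] := clamp_itv t.
by rewrite /edge_bary; case: eqP => // _; case: eqP => //; rewrite subr_ge0.
Qed.

Lemma edge_sum t : \sum_(B \in [set: set (artin Γ)]) edge_bary t B = 1.
Proof.
have D01 : dcoset 1%g set0 != dcoset 1%g [set a].
  by apply: dcoset_neq => /(_ a erefl).
rewrite -(@fsbig_widen _ _ _ _ [set` [:: dcoset 1%g set0; dcoset 1%g [set a]]]) //.
  rewrite -fsbig_seq /= ?inE ?D01 // !big_cons big_nil /edge_bary !eqxx eq_sym (negPf D01).
  ring.
move=> B [_ nB] /=; apply/eqP/negPn/negP => /edge_supp e.
by apply: nB; case: e => -> /=; rewrite !inE eqxx ?orbT.
Qed.

Definition edge_point (t : R) : deligne Γ R :=
  Deligne (@edge_vertex t) (@edge_chain t) (@edge_ge0 t) (edge_sum t).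

Lemma edge_point_supported t :
  supported (edge_point t) [set dcoset 1%g set0; dcoset 1%g [set a]].
Proof. by move=> B /edge_supp. Qed.

Lemma edge_dist s t : (deligne_dist (edge_point s) (edge_point t) <= `|s - t|%:E)%E.
Proof.
have len : string_length (edge_point s) (edge_point t) (`|clamp s - clamp t| + 0).
  apply: StringCons (StringNil _).
  have := InEdge (@edge_point_supported s) (@edge_point_supported t).
  by rewrite /= /edge_bary eqxx.
apply: ge_ereal_inf; exists (`|clamp s - clamp t| + 0)%:E.
  by exists (`|clamp s - clamp t| + 0).
by rewrite addr0 lee_fin clamp_lipschitz.
Qed.

Lemma edge_point_pos t : 0 < t <= 1 -> edge_point t (dcoset 1%g set0) != 0 /\
  forall B, edge_point t B != 0 -> dcoset 1%g set0 `<=` B.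
Proof.
move=> /andP[t0 t1]; split.
  by rewrite /= /edge_bary eqxx clamp_id ?gt_eqF // ltW.
by move=> B /edge_supp[] -> //; exact: dcoset0_sub.
Qed.

Lemma edge_point0 : edge_point 0 (dcoset 1%g [set a]) != 0 /\
  forall B, edge_point 0 B != 0 -> dcoset 1%g [set a] `<=` B.
Proof.
have D10 : dcoset 1%g [set a] != dcoset 1%g set0.
  by rewrite eq_sym; apply: dcoset_neq => /(_ a erefl).
have c0 : clamp 0 = 0 by rewrite clamp_id ?lexx ?ler01.
split; first by rewrite /= /edge_bary (negPf D10) eqxx c0 subr0 oner_neq0.
move=> B nz; case: (edge_supp nz) => eqB; last by rewrite eqB.
by move: nz; rewrite eqB /= /edge_bary eqxx c0 eqxx.
Qed.

End Edge.

(** All these edges start at {1}, so one g serves for all generators. *)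
Lemma edge_point1 a b : edge_point a 1 = edge_point b 1.
Proof.
have c1 : clamp 1 = 1 by rewrite clamp_id ?lexx ?ler01.
by apply: deligneP => B; rewrite /= /edge_bary c1 subrr !if_same.
Qed.

End Metric.

(** * Images of edges under an equivariant isometry *)

Section EquivariantIsometry.
Variables (R : realType) (Γ : lgraph) (psi : aut (artin Γ)).
Variable f : deligne Γ R -> deligne Γ R.
Hypotheses (hiso : deligne_isometry f) (hequiv : equivariant psi f).
Implicit Types (a b : Γ) (g h : artin Γ) (S : set Γ) (B : set (artin Γ)).

Lemma lipschitz_open (phi : R -> R) :
  (forall s t, `|phi s - phi t| <= 2 * `|s - t|)%R -> open [set t | 0 < phi t]%R.
Proof.
move=> lip; rewrite openE => t /= pt; apply/nbhs_ballP.
exists (phi t / 2)%R => [|s /=]; first by rewrite /= divr_gt0.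
rewrite /ball /= => ts; have := lip t s.
have := ler_norm (phi t - phi s)%R; lra.
Qed.

Lemma equivariant_stabilizer x k :
  deligne_act (psi k) (f x) = f x <-> deligne_act k x = x.
Proof. by rewrite -hequiv; split=> [/(bij_inj hiso.1)|->]. Qed.

Lemma edge_image_open a B : open [set t | 0 < f (edge_point a t) B]%R.
Proof.
apply: lipschitz_open => s t; apply: deligne_dist_bary.
by rewrite hiso.2; exact: edge_dist.
Qed.

Lemma bary_neq0 (x : deligne Γ R) B : x B != 0%R <-> (0 < x B)%R.
Proof. by rewrite lt_neqAle bary_ge0 andbT eq_sym. Qed.

(** The stabilizer is trivial for t > 0, hence also at the image. If the smallest coset g A_S there
    had some b in S, then g b g^-1, which is not 1, would fix the image. *)
Lemma edge_image_vertex a t : (0 < t <= 1)%R ->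
  exists g, (0 < f (edge_point a t) (dcoset g set0))%R.
Proof.
move=> t01; have [nz sub] := edge_point_pos a t01.
have [g [S [tS /bary_neq0 fnz fsub]]] := min_vertex (f (edge_point a t)).
exists g; suff S0 : S = set0 by rewrite -S0.
apply/seteqP; split=> // b Sb; case: (@gen_neq1 R Γ b).
have [psi' psiK psi'K] := aut_bij psi.
pose k := psi' (g * gen b * g^-1).
have k1 : k = 1.
  apply: parabolic0; rewrite -[k]mul1g -[1 * k]mulg1 -{1}invg1.
  apply/(stabilizerP k nz sub)/equivariant_stabilizer.
  apply/(stabilizerP _ _ fsub); first by apply/bary_neq0.
  by rewrite psi'K !mulgA mulVg mul1g mulgVK; exact: parabolic_genP.
move: (psi'K (g * gen b * g^-1)); rewrite -/k k1 aut1.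
move=> /esym/(congr1 (fun h => g^-1 * h * g)).
by rewrite !mulgA mulVg mul1g mulgVK mulg1 mulVg.
Qed.

(** This is the disjointness of the open stars of the vertices {g}. *)
Lemma bary_singleton_uniq (x : deligne Γ R) g h :
  (0 < x (dcoset g set0))%R -> (0 < x (dcoset h set0))%R -> g = h.
Proof.
move=> /bary_neq0 xg /bary_neq0 xh.
have sub k l : dcoset k set0 `<=` dcoset l set0 -> k = l.
  move=> /(_ _ (dcoset_refl k set0))/dcosetP/parabolic0 e.
  by rewrite -(mulVKg l k) e mulg1.
by have [/sub //|/sub] := bary_chain xg xh.
Qed.

(* The open stars of the vertices {g} are pairwise disjoint and cover the
   image of the half-open edge, which is connected. *)
Lemma edge_image_star a g t : (0 < t <= 1)%R ->
  (0 < f (edge_point a 1%R) (dcoset g set0))%R ->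
  (0 < f (edge_point a t) (dcoset g set0))%R.
Proof.
move=> /andP[t0 t1] pos1.
pose U h := [set s | 0 < f (edge_point a s) (dcoset h set0)]%R.
pose V := \bigcup_(h in [set h | h <> g]) U h.
have Vo : open V by apply: bigcup_open => h _; exact: edge_image_open.
have eqB : `[t, 1%R] `&` U g = `[t, 1%R].
  apply: (@segment_connected R t 1%R).
  - exists 1%R; split=> //=; first by rewrite in_itv /= t1 lexx.
  - by exists (U g) => //; exact: edge_image_open.
  - exists (~` V); first exact: open_closedC.
    apply/seteqP; split=> s [] /=; rewrite in_itv /= => /andP[ts s1].
      move=> Us; split=> //; first by rewrite ts s1.
      by move=> [h /= hg Uh]; apply: hg; apply: bary_singleton_uniq Uh Us.
    move=> nV; split; first by rewrite ts s1.
    have [|h hpos] := @edge_image_vertex a s; first by rewrite s1 (lt_le_trans t0 ts).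
    have [<- //|/eqP hg] := eqVneq h g.
    by case: nV; exists h.
by have : (`[t, 1%R] `&` U g) t by [rewrite eqB /= in_itv /= lexx t1] => -[].
Qed.

(** By openness the coordinate at B stays positive for small t > 0, where the one at {g} is positive
    too; so B and {g} lie in a common chain. *)
Lemma edge_image0_star a g B :
  (0 < f (edge_point a 1%R) (dcoset g set0))%R ->
  f (edge_point a 0%R) B != 0%R -> B g.
Proof.
move=> pos1 /bary_neq0 posB; have := @edge_image_open a B.
rewrite openE => /(_ _ posB) /nbhs_ballP [e /= e0 sube].
pose t : R := Num.min 1%R (e / 2)%R.
have t01 : (0 < t <= 1)%R by rewrite lt_min ltr01 divr_gt0 //= ge_min lexx.
have posBt : (0 < f (edge_point a t) B)%R.
  apply: sube; rewrite /ball /= sub0r normrN gtr0_norm; last by case/andP: t01.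
  by rewrite gt_min; apply/orP; right; lra.
have posgt := edge_image_star t01 pos1.
move/bary_neq0 in posBt; move/bary_neq0 in posgt.
have [h [S [_ eqB]]] := bary_vertex posBt; rewrite eqB in posBt *.
have [sub|sub] := bary_chain posgt posBt; first exact: sub (dcoset_refl g set0).
have /dcosetP/parabolic0 e1 := sub _ (dcoset_refl h S).
by have -> : g = h; [rewrite -(mulVKg g h) e1 mulg1 | exact: dcoset_refl].
Qed.

(** The image of the vertex <a> has stabilizer psi <a> = g A_S g^-1. An empty S would make psi(a)
    trivial, and an edge {s, t} would make s and t commute, against m_st >= 3. *)
Lemma image_cyclic a g : large_type Γ ->
  (0 < f (edge_point a 1%R) (dcoset g set0))%R ->
  exists c, forall h, parabolic [set a] h <-> parabolic [set c] (g^-1 * psi h * g).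
Proof.
move=> large pos1; have [nz sub] := edge_point0 R a.
have [g' [S [tS fnz fsub]]] := min_vertex (f (edge_point a 0%R)).
have eqg := dcoset_eq (edge_image0_star pos1 fnz); rewrite eqg in fnz fsub.
have stab h : parabolic [set a] h <-> parabolic S (g^-1 * psi h * g).
  split=> [ah|Sh].
    apply/(stabilizerP _ fnz fsub)/equivariant_stabilizer/(stabilizerP _ nz sub).
    by rewrite invg1 mul1g mulg1.
  rewrite -[h]mul1g -[1 * h]mulg1 -{1}invg1.
  by apply/(stabilizerP _ nz sub)/equivariant_stabilizer/(stabilizerP _ fnz fsub).
have [psi' psiK psi'K] := aut_bij psi.
have preim s : S s -> exists2 k, parabolic [set a] k & psi k = g * gen s * g^-1.
  move=> Ss; exists (psi' (g * gen s * g^-1)); last exact: psi'K.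
  by apply/stab; rewrite psi'K !mulgA mulVg mul1g mulgVK; exact: parabolic_genP.
case: tS => [S0|[c Sc]|[s [t [st Sst]]]].
- have /stab := @parabolic_set1 Γ a; rewrite S0 => /parabolic0 e.
  case: (@gen_neq1 R Γ a); apply: (can_inj psiK); rewrite aut1.
  have -> : psi (gen a) = g * (g^-1 * psi (gen a) * g) * g^-1.
    by rewrite !mulgA mulgV mul1g mulgK.
  by rewrite e mulg1 mulgV.
- by exists c => h; rewrite -Sc.
- have [k1 ak1 psik1] : exists2 k, parabolic [set a] k & psi k = g * gen s * g^-1.
    by apply: preim; rewrite Sst; left.
  have [k2 ak2 psik2] : exists2 k, parabolic [set a] k & psi k = g * gen t * g^-1.
    by apply: preim; rewrite Sst; right.
  case: (@gen_noncomm R Γ s t st (large _ _ st)).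
  have /(congr1 psi) := parabolic_set1_comm ak1 ak2.
  rewrite !autM psik1 psik2 !mulgA !mulgVK.
  by move=> /mulIg; rewrite -!mulgA => /mulgI.
Qed.

End EquivariantIsometry.

Theorem theorem5p4 (R : realType) (Γ : lgraph)
    (hlarge : large_type Γ) (hconn : connected_graph Γ)
    (psi : aut (artin Γ)) (f : deligne Γ R -> deligne Γ R)
    (hiso : deligne_isometry f) (hequiv : equivariant psi f) :
  Aut_graph Γ psi.
Proof.
have [g gP] : exists g, forall a, exists c, forall h,
    parabolic [set a] h <-> parabolic [set c] (g^-1 * psi h * g).
  (* The vertex {g} whose open star contains the image of {1} provides g; for the empty graph any g
     will do. *)
  case: (pickP (mem Γ)) => [a0 _|no]; last by exists 1 => a; have := no a.
  have [|g pos] := edge_image_vertex hiso hequiv a0 (t := 1%R).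
    by rewrite ltr01 lexx.
  exists g => a; apply: (image_cyclic hiso hequiv hlarge).
  by rewrite (edge_point1 R a a0).
exact: (aut_conj_cyclic R hlarge hconn gP).
Qed.
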